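(* Let $d>2$ be an integer, let $\alpha$ be a Pisot number and let $\lambda=\alpha^{-1}$. Let $\mu_\lambda$ be the Hutchinson measure on $\mathbb{R}^d$ of the IFS $\{\tau_b(x)=\lambda(x+b)\}_{b\in B_d}$ with $B_d=\{\mathbf 0,\mathbf e_1,\dots,\mathbf e_d\}$ and equal weights $\frac1{d+1}$, and for $\xi\in\mathbb{R}$ put $$\hat\mu_{\lambda,B,W}(\xi)=\hat\mu_\lambda([\xi,\dots,\xi]^t)=\prod_{n=1}^\infty\frac1{d+1}\bigl(1+d\,e^{2\pi i\lambda^n\xi}\bigr).$$ Then the sequence $\{|\hat\mu_{\lambda,B,W}(\alpha^k)|\}_{k=1}^\infty$ is bounded below by a positive constant.
   Context: A Pisot number is an algebraic integer $\alpha>1$ (real) all of whose Galois conjugates other than $\alpha$ itself have modulus less than $1$. $\mathbf e_i$ is the $i$th standard basis vector of $\mathbb{R}^d$. The Hutchinson measure of the contractive affine IFS $\{\tau_b\}_{b\in B_d}$ with equal weights is the unique Borel probability measure $\mu$ on $\mathbb{R}^d$ satisfying $\mu=\frac{1}{d+1}\sum_{b\in B_d}\mu\circ\tau_b^{-1}$. The Fourier transform is $\hat\mu(\xi)=\int e^{i2\pi\xi\cdot x}\,d\mu(x)$. *)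

(* Defs.v *)
From HB Require Import structures.
From mathcomp Require Import all_boot all_order all_algebra.
From mathcomp Require Import complex.
From mathcomp Require Import all_classical all_reals all_analysis.

Set Implicit Arguments.
Unset Strict Implicit.
Unset Printing Implicit Defensive.

Import Order.TTheory GRing.Theory Num.Theory.
Import numFieldNormedType.Exports.

Local Open Scope classical_set_scope.
Local Open Scope ring_scope.
Local Open Scope complex_scope.

Definition is_minimal_polynomial (F : numFieldType) (p : {poly rat}) (a : F) :=
  [/\ p \is monic, irreducible_poly p & root (map_poly ratr p) a].

Definition galois_conjugate (F : numFieldType) (a z : F) :=
  exists2 p : {poly rat}, is_minimal_polynomial p a & root (map_poly ratr p) z.

Definition pisot (R : realType) (alpha : R) :=
  [/\ integralOver (intr : int -> R) alpha,
      1 < alpha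
    & forall z : R[i],
        galois_conjugate (alpha%:C : R[i]) z -> z != alpha%:C -> `|z| < 1].

(* R^d with its Borel sigma-algebra, generated by the open sets. *)
Definition borel_space (R : realType) (d : nat) :=
  g_sigma_algebraType (@open 'cV[R]_d).

Definition digits (R : realType) (d : nat) : seq 'cV[R]_d :=
  0 :: [seq delta_mx i 0 | i : 'I_d].

Definition tau (R : realType) (d : nat) (lambda : R) (b x : 'cV[R]_d) :
  'cV[R]_d := lambda *: (x + b).

Definition hutchinson_measure (R : realType) (d : nat) (lambda : R)
    (mu : probability (borel_space R d) R) :=
  forall A : set (borel_space R d), measurable A ->
    mu A = ((d.+1%:R^-1)%:E *
            \sum_(b <- digits R d) mu (tau lambda b @^-1` A))%E.

Definition dotv (R : realType) (d : nat) (u v : 'cV[R]_d) : R :=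
  \sum_(i < d) u i 0 * v i 0.

(* e^{i t} for real t *)
Definition expi (R : realType) (t : R) : R[i] := cos t +i* sin t.

Definition Cintegral dsp (T : measurableType dsp) (R : realType)
    (mu : {measure set T -> \bar R}) (f : T -> R[i]) : R[i] :=
  (\int[mu]_x complex.Re (f x)) +i* (\int[mu]_x complex.Im (f x)).

Definition fourier (R : realType) (d : nat)
    (mu : probability (borel_space R d) R) (xi : 'cV[R]_d) : R[i] :=
  Cintegral mu (fun x : borel_space R d => expi (2 * pi * dotv xi x)).

Definition fourier_diag (R : realType) (d : nat)
    (mu : probability (borel_space R d) R) (xi : R) : R[i] :=
  fourier mu (const_mx xi).

(* Main.v *)
Require Import Defs.
From HB Require Import structures.
From mathcomp Require Import all_boot all_order all_algebra.
From mathcomp Require Import complex.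
From mathcomp Require Import all_classical all_reals all_analysis.
From mathcomp Require Import measurable_realfun.
From mathcomp Require Import ring lra zify.

(* Invariance of mu gives phi(xi) = m(lambda xi) phi(lambda xi) for the mask
   m(t) = (1 + d e^{2 pi i t}) / (d + 1), and phi(lambda^N xi) tends to 1; this
   yields the infinite product and phi(1) <> 0, since m never vanishes.  With
   lambda = 1 / alpha, phi(alpha^k) is phi(1) times the product of the
   m(alpha^j) for j < k.  The power sums of the conjugates of alpha are
   integers, so the Pisot property puts alpha^j within D theta^j of an integer
   for some theta < 1.  As |m(t)| >= exp (- K dist(t, Z)), the product is at
   least exp (- K D / (1 - theta)) for every k. *)

Set Implicit Arguments.
Unset Strict Implicit.
Unset Printing Implicit Defensive.

Import Order.TTheory GRing.Theory Num.Theory.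
Import numFieldNormedType.Exports.

Local Open Scope classical_set_scope.
Local Open Scope ring_scope.
Local Open Scope complex_scope.

(** * Power sums of the roots of an integral polynomial *)

(* With P the product of the X - z, the power sum of order j is the coefficient
   of X^(n-1), n = deg P, in the remainder of X^j P' modulo P: indeed P' is the
   sum of the P / (X - z), and X^j - z^j is a multiple of X - z.  The remainder
   is integral when P is. *)
Lemma power_sum_coef (C : comNzRingType) (r : seq C) (j : nat) :
  exists h R : {poly C},
    [/\ 'X^j * (\prod_(z <- r) ('X - z%:P))^`() =
          h * \prod_(z <- r) ('X - z%:P) + R,
        (size R <= size r)%N
      & R`_(size r).-1 = \sum_(z <- r) z ^+ j].
Proof.
elim: r => [|z r [h [R [E sR cR]]]].
  exists 0, 0; rewrite !big_nil derivC mulr0 mul0r addr0.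
  by rewrite size_poly0 coef0.
set P := \prod_(z <- r) _ in E.
have sP : size P = (size r).+1 by rewrite size_prod_XsubC.
(* With [S] the sum over [i < j], ['X^j = S * ('X - z) + z^j]. Substituting this in ['X^j * (('X -
   z) * P)' = 'X^j * P + ('X - z) * ('X^j * P')] gives the quotient [S + h] and the remainder
   below. *)
exists ((\sum_(i < j) 'X^(j.-1 - i) * (z%:P) ^+ i) + h),
  ((z ^+ j)%:P * P + ('X - z%:P) * R).
rewrite !big_cons -/P; split.
- have := subrXX 'X (z%:P) j; set S := \sum_(i < j) _ => /eqP.
  rewrite subr_eq polyC_exp => /eqP EX.
  rewrite derivM derivXsubC mul1r mulrDr mulrCA E EX; ring.
- apply: leq_trans (size_polyD _ _) _; rewrite geq_max; apply/andP; split.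
    by rewrite mul_polyC (leq_trans (size_scale_leq _ _)) ?sP.
  apply: leq_trans (size_polyMleq _ _) _.
  by rewrite size_XsubC.
- rewrite /= coefD coefCM mulrBl coefB coefXM coefCM (nth_default 0 sR) mulr0 subr0.
  have /monicP : P \is monic by rewrite monic_prod_XsubC.
  rewrite lead_coefE sP /= => ->; rewrite mulr1 -cR; congr (_ + _).
  (* For empty [r] the predecessor of the size is again 0; there [R] has size 0, so both sides
     vanish. *)
  case: eqP => // r0; move: sR; rewrite r0 leqn0 size_poly_eq0 => /eqP ->.
  by rewrite coef0.
Qed.

(** Division by a monic polynomial commutes with [map_poly intr], because the remainder is unique.
    The coefficient giving the power sum is therefore the image of an integer coefficient. *)
Lemma power_sum_int (C : comNzRingType) (p : {poly int}) (r : seq C) (j : nat) :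
  map_poly intr p = \prod_(z <- r) ('X - z%:P) -> p \is monic ->
  exists s : int, \sum_(z <- r) z ^+ j = s%:~R.
Proof.
move=> Ep mp; have [h [R [E sR <-]]] := power_sum_coef r j.
rewrite -Ep in E; set q := map_poly intr p in E.
have mq : q \is monic by rewrite /q Ep monic_prod_XsubC.
have sq : size q = (size r).+1 by rewrite /q Ep size_prod_XsubC.
have sp : size p = size q.
  by rewrite size_map_poly_id0 // (monicP mp) rmorph1 oner_neq0.
pose f := 'X^j * p^`(); pose R0 := Pdiv.Ring.rmodp f p.
exists R0`_(size r).-1.
rewrite -coef_map; congr (_`__).
have ER : R = Pdiv.Ring.rmodp ('X^j * q^`()) q.
  by rewrite E (Pdiv.RingMonic.rmodp_addl_mul_small mq) // sq ltnS.
have Ef : 'X^j * q^`() = map_poly intr (Pdiv.Ring.rdivp f p) * q + map_poly intr R0.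
  rewrite -rmorphM -rmorphD -(Pdiv.RingMonic.rdivp_eq mp) rmorphM /= map_polyXn.
  by rewrite deriv_map.
rewrite ER Ef (Pdiv.RingMonic.rmodp_addl_mul_small mq) //.
apply: leq_ltn_trans (size_poly _ _) _.
by rewrite -sp Pdiv.Ring.ltn_rmodpN0 // monic_neq0.
Qed.

(** * Minimal polynomials of algebraic integers *)

(** Strong induction on the size: a reducible [f] splits into two smaller factors, and [a] is a root
    of one of them. *)
Lemma minimal_factor (F : numFieldType) (a : F) (f : {poly rat}) :
  f != 0 -> root (map_poly ratr f) a ->
  exists2 p : {poly rat}, p %| f & is_minimal_polynomial p a.
Proof.
elim: (size f) {-2}f (leqnn (size f)) => [|n IH] {}f.
  by rewrite leqn0 size_poly_eq0 => ->.
move=> sf f0 fa.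
have [irr|nirr] := pselect (irreducible_poly f).
  have lf0 : (lead_coef f)^-1 != 0 by rewrite invr_eq0 lead_coef_eq0.
  exists ((lead_coef f)^-1 *: f); first by rewrite dvdpZl.
  split.
  - by rewrite monicE lead_coefZ mulVf // lead_coef_eq0.
  - case: irr => s1 irr; split=> [|q sq qf]; first by rewrite size_scale.
    rewrite eqp_sym (eqp_ltrans (eqp_scale _ lf0)) eqp_sym.
    by apply: irr => //; rewrite -(dvdpZr _ _ lf0).
  - by rewrite map_polyZ rootZ // fmorph_eq0.
have s1f : (1 < size f)%N.
  rewrite ltnNge; apply/negP => /size1_polyC Ef.
  move: fa f0; rewrite Ef map_polyC rootC fmorph_eq0 polyC_eq0 => /eqP ->.
  by rewrite eqxx.
have [q [sq1 [u Ef] neq]] :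
    exists q : {poly rat}, [/\ size q != 1, exists u, f = u * q & ~~ (q %= f)].
  apply: contrapT => H; apply: nirr; split => // q sq1 qf.
  apply: contrapT => /negP nqf; apply: H; exists q; split=> //.
  by apply/dvdpP.
have q0 : q != 0 by apply: contraNneq f0 => q0; rewrite Ef q0 mulr0.
have u0 : u != 0 by apply: contraNneq f0 => u0; rewrite Ef u0 mul0r.
have qf : q %| f by rewrite Ef dvdp_mull.
have uf : u %| f by rewrite Ef dvdp_mulr.
have sqf : (size q <= n)%N.
  rewrite -ltnS; apply: leq_trans sf.
  by rewrite ltn_neqAle (dvdp_leq f0 qf) andbT dvdp_size_eqp.
have suf : (size u <= n)%N.
  rewrite -ltnS; apply: leq_trans sf.
  have : (0 < size q)%N by rewrite size_poly_gt0.
  rewrite Ef size_mul // ; case: (size q) sq1 => [|[|m]] // _ _.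
  by rewrite !addnS /= ltnS leq_addr.
move: fa; rewrite Ef rmorphM rootM => /orP[ua|qa].
  have [p pu mp] := IH _ suf u0 ua.
  by exists p => //; rewrite -Ef (dvdp_trans pu).
have [p pu mp] := IH _ sqf q0 qa.
by exists p => //; rewrite -Ef (dvdp_trans pu).
Qed.

(** Conjugates are defined by a rational minimal polynomial, while integrality of power sums needs
    integer coefficients; this lemma links the two. *)
Lemma integral_minimal_polynomial (F : numFieldType) (a : F) :
  integralOver (intr : int -> F) a ->
  exists2 p : {poly int}, p \is monic
    & is_minimal_polynomial (map_poly intr p) a.
Proof.
move=> [f mf fa].
have Emap (g : {poly int}) : map_poly ratr (map_poly intr g) = map_poly intr g :> {poly F}.
  by rewrite -map_poly_comp; apply: eq_map_poly => x; rewrite /= ratr_int.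
have [p pf mp] : exists2 p : {poly rat}, p %| map_poly intr f & is_minimal_polynomial p a.
  apply: minimal_factor; last by rewrite Emap.
  by rewrite map_poly_eq0_id0 // ?(monicP mf) ?rmorph1 ?oner_eq0 // monic_neq0.
(* Gauss's lemma: p is a rational multiple of an integral factor p1 of f. *)
have [p1 [c c0 Ep] [r Ef]] := dvdpP_rat_int pf.
have lc : lead_coef p1 * lead_coef r = 1 by rewrite -lead_coefM -Ef (monicP mf).
have [mon _ _] := mp.
have : lead_coef p1 = 1 \/ lead_coef p1 = -1.
  have /eqP := congr1 absz lc; rewrite abszM /= muln_eq1 => /andP[/eqP + _].
  by move: (lead_coef p1) => x; lia.
have Elc : c * (lead_coef p1)%:~R = 1.
  move/monicP: mon; rewrite Ep lead_coefZ lead_coef_map_inj //; exact: intr_inj.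
case=> l1.
  exists p1; first by rewrite monicE l1.
  by move: Elc mp; rewrite Ep l1 mulr1 => ->; rewrite scale1r.
(* Here [c = -1], so [p] is the image of [- p1]. *)
exists (- p1); first by rewrite monicE lead_coefN l1 opprK.
move: Elc mp; rewrite Ep l1 rmorphN rmorphN /= rmorph1 mulrN1 => /eqP.
by rewrite eqr_oppLR => /eqP ->; rewrite scaleN1r.
Qed.

(** In characteristic 0 the derivative of an irreducible [p] is nonzero and of smaller size, hence
    coprime to [p], and the two share no root. *)
Lemma minimal_polynomial_simple_root (F : numFieldType) (a : F) (p : {poly rat}) :
  is_minimal_polynomial p a -> ~~ root (map_poly ratr p)^`() a.
Proof.
move=> [mp [s1 irr] pa].
have p0 : p != 0 by rewrite monic_neq0.
have sp' : (size p^`() < size p)%N by rewrite lt_size_deriv.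
have p'0 : p^`() != 0.
  apply/eqP => /(congr1 (fun q : {poly rat} => q`_(size p).-2)) /eqP.
  rewrite coef_deriv coef0; apply/negP; move: mp; rewrite monicE lead_coefE.
  by case: (size p) s1 => [|[|m]] // _ /eqP /= ->; rewrite pnatr_eq0.
have cop : coprimep p p^`().
  rewrite coprimep_def; apply: contraT => /irr /(_ (dvdp_gcdl _ _)) E.
  have := dvdp_gcdr p p^`(); rewrite (eqp_dvdl _ E) => /(dvdp_leq p'0).
  by rewrite leqNgt sp'.
rewrite deriv_map; apply: (coprimep_root _ pa).
by rewrite coprimep_map.
Qed.

(** * Powers of a Pisot number are close to integers *)

Lemma normr_complex (R : rcfType) (x : R) : `|x%:C%C| = `|x|%:C%C.
Proof. by rewrite normc_def /= expr0n addr0 sqrtr_sqr. Qed.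

(** The nearby integer is the power sum of all the conjugates; the error is the sum of [z ^+ j] over
    those other than [alpha]. [D] counts these and [theta] bounds their moduli. *)
Lemma pisot_near_int (R : realType) (alpha : R) :
  pisot alpha -> exists D theta : R, [/\ 0 <= D, 0 <= theta, theta < 1 &
    forall j, exists n : int, `|alpha ^+ j - n%:~R| <= D * theta ^+ j].
Proof.
move=> [[f mf fa] a1 conj].
have [p mp minp] : exists2 p : {poly int}, p \is monic
    & is_minimal_polynomial (map_poly intr p) (alpha%:C%C : R[i]).
  apply: integral_minimal_polynomial; exists f => //.
  have -> : map_poly intr f = map_poly (real_complex R) (map_poly intr f).
    by rewrite -map_poly_comp; apply: eq_map_poly => x; rewrite /= rmorph_int.
  by rewrite fmorph_root.
have Emap : map_poly ratr (map_poly intr p : {poly rat}) = map_poly intr p :> {poly R[i]}.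
  by rewrite -map_poly_comp; apply: eq_map_poly => x; rewrite /= ratr_int.
have [r Er] := closed_field_poly_normal (map_poly intr p : {poly R[i]}).
rewrite lead_coef_map_eq ?(monicP mp) ?rmorph1 ?oner_eq0 // scale1r in Er.
have ar : alpha%:C%C \in r.
  by rewrite -root_prod_XsubC -Er -Emap; case: minp.
set r' := rem alpha%:C%C r.
have Pr := perm_to_rem ar.
(* A second occurrence of [alpha] would make it a root of the derivative too. Hence every element of
   [r'] is a conjugate distinct from [alpha]. *)
have ar' : alpha%:C%C \notin r'.
  apply: contra (minimal_polynomial_simple_root minp) => h.
  rewrite Emap Er (perm_big _ Pr) big_cons /= derivM derivXsubC mul1r.
  rewrite rootE hornerD hornerM hornerXsubC subrr mul0r addr0.
  by rewrite -/r' -rootE root_prod_XsubC.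
have zr z : z \in r' -> `|z| < 1.
  move=> zr'; apply: conj; last by apply: contraNneq ar' => <-.
  exists (map_poly intr p) => //; rewrite Emap Er root_prod_XsubC.
  exact: mem_rem zr'.
(* [theta] is the maximum of finitely many moduli below 1, or 0 when [r'] is empty. *)
have [theta [t0 t1 tz]] : exists theta : R, [/\ 0 <= theta, theta < 1 & 
    forall z, z \in r' -> `|z| <= theta%:C%C].
  elim: (r') zr => [|z s IH] zs; first by exists 0; split.
  have [|th [h0 h1 hz]] := IH; first by move=> y ys; apply: zs; rewrite inE ys orbT.
  have z1 := zs z (mem_head _ _); rewrite normc_def ltcR in z1 *.
  exists (Num.max th (Num.sqrt (complex.Re z ^+ 2 + complex.Im z ^+ 2))).
  split; first by rewrite le_max h0.
    by rewrite gt_max h1 z1.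
  move=> y; rewrite inE => /orP[/eqP ->|/hz yh].
    by rewrite normc_def lecR le_max lexx orbT.
  by rewrite (le_trans yh) // lecR le_max lexx.
exists (size r')%:R, theta; split => // j.
have [n En] := power_sum_int j Er mp.
exists n; rewrite -lecR -normr_complex rmorphB rmorphXn /= rmorph_int -En.
rewrite (perm_big _ Pr) big_cons opprD addNKr normrN -/r'.
apply: le_trans (ler_norm_sum _ _ _) _.
rewrite rmorphM rmorphXn /= rmorph_nat mulr_natl -[size r']count_predT -iter_addr_0 -big_const_seq.
rewrite !big_seq; apply: ler_sum => z zr'.
by rewrite normrX lerXn2r ?nnegrE ?normr_ge0 ?tz // lecR.
Qed.

(** * The map [expi]: Lipschitz bound and periodicity *)

Lemma lipschitz_of_derive (R : realType) (f df : R -> R) (x y : R) :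
  (forall z : R, is_derive z 1 f (df z)) -> (forall z, `|df z| <= 1) ->
  `|f x - f y| <= `|x - y|.
Proof.
move=> fdf df1; wlog yx : x y / y <= x.
  by move=> H; case: (leP y x) => [/H//|/ltW /H]; rewrite distrC [X in _ <= X]distrC.
have cf : {within `[y, x], continuous f}.
  apply: continuous_subspaceT => z; apply: differentiable_continuous.
  by apply/derivable1_diffP; case: (fdf z).
have [c _ ->] := MVT_segment yx (fun z _ => fdf z) cf.
by rewrite normrM ler_piMl.
Qed.

Lemma expiD (R : realType) (s t : R) : expi (s + t) = expi s * expi t.
Proof. by rewrite /expi cosD sinD; simpc; congr (_ +i* _); rewrite addrC. Qed.

Lemma expi0 (R : realType) : expi (0 : R) = 1.
Proof. by rewrite /expi cos0 sin0. Qed.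

Lemma norm_expi (R : realType) (t : R) : `|expi t| = 1.
Proof. by rewrite normc_def /= cos2Dsin2 sqrtr1. Qed.

Lemma norm_complex_le (R : rcfType) (z : R[i]) :
  `|z| <= (`|complex.Re z| + `|complex.Im z|)%:C.
Proof.
case: z => a b /=.
have -> : (a +i* b)%C = a%:C + 'i * b%:C by simpc.
rewrite (le_trans (ler_normD _ _)) // normrM !normr_complex.
by rewrite (normc_def 'i) /= expr0n /= add0r expr1n sqrtr1 mul1r rmorphD.
Qed.

(** The factor 2 comes from bounding the modulus by the sum of the real and imaginary parts, each of
    which is 1-Lipschitz. *)
Lemma norm_expi_sub1 (R : realType) (t : R) : `|expi t - 1| <= (2 * `|t|)%:C.
Proof.
apply: le_trans (norm_complex_le _) _; rewrite lecR /= subr0 mulr_natl mulr2n.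
apply: lerD.
  rewrite -{1}(cos0 R) -[X in _ <= `|X|]subr0.
  apply: (@lipschitz_of_derive _ _ (fun z => - sin z)) => z; rewrite normrN.
  exact: sin_max.
rewrite -[X in `|X| <= _]subr0 -{1}(sin0 R) -[X in _ <= `|X|]subr0.
apply: (@lipschitz_of_derive _ _ (@cos R)) => z; exact: cos_max.
Qed.

Lemma expi_int (R : realType) (n : int) : expi (2 * pi * n%:~R : R) = 1.
Proof.
have Hn (m : nat) : expi (2 * pi * m%:R : R) = 1.
  elim: m => [|m IH]; first by rewrite mulr0 expi0.
  rewrite -[m.+1%:R]natr1 mulrDr expiD IH mul1r mulr1 /expi mulr_natl.
  by rewrite cos2pi sin2pi.
case: n => m; first exact: Hn.
have : expi (- (2 * pi * m.+1%:R)) * expi (2 * pi * m.+1%:R) = 1 :> R[i].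
  by rewrite -expiD addNr expi0.
by rewrite Hn mulr1 NegzE mulrNz mulrN.
Qed.

(** * Lower bounds for the mask and its products *)

(** The Fourier transform, at the diagonal vector with entries [t], of the uniform measure on the
    digits: [0] contributes 1 and each basis vector the same exponential. *)
Definition ifs_mask (R : realType) (d : nat) (t : R) : R[i] :=
  (d.+1%:R)^-1 * (1 + d%:R * expi (2 * pi * t)).

Lemma norm_mask_le1 (R : realType) (d : nat) (t : R) : `|ifs_mask d t| <= 1.
Proof.
rewrite /ifs_mask normrM normfV normr_nat mulrC ler_pdivrMr ?ltr0n // mul1r.
apply: le_trans (ler_normD _ _) _.
by rewrite normr1 normrM norm_expi mulr1 normr_nat -natr1 addrC.
Qed.

(** By the reverse triangle inequality the bracket has modulus at least [d - 1], which is at least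
    1. *)
Lemma norm_mask_ge (R : realType) (d : nat) (t : R) :
  (1 < d)%N -> (d.+1%:R^-1 : R)%:C <= `|ifs_mask d t|.
Proof.
move=> d1; rewrite /ifs_mask normrM normfV normr_nat rmorphV ?unitfE ?pnatr_eq0 //=.
rewrite rmorph_nat ler_peMr ?invr_ge0 ?ler0n // addrC.
have := lerB_normD (d%:R * expi (2 * pi * t) : R[i]) 1.
apply: le_trans; rewrite normrM norm_expi mulr1 normr_nat normr1.
by rewrite lerBrDr -[1 + 1]/(2%:R) ler_nat.
Qed.

(** The mask is 1 at integers and [expi (2 * pi * t)] has period 1 in [t]. The constant [4 * pi] is
    [2 * pi] times the factor 2 of [norm_expi_sub1]. *)
Lemma norm_mask_near_int (R : realType) (d : nat) (t : R) (n : int) :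
  (1 - 4 * pi * `|t - n%:~R|)%:C <= `|ifs_mask d t|.
Proof.
have E : expi (2 * pi * t) = expi (2 * pi * (t - n%:~R)).
  by rewrite -[RHS]mulr1 -(expi_int R n) -expiD -mulrDr subrK.
have Em : ifs_mask d t = 1 + d%:R / d.+1%:R * (expi (2 * pi * t) - 1).
  have d0 : (d.+1%:R : R[i]) != 0 by rewrite pnatr_eq0.
  by rewrite /ifs_mask; apply: (mulfI d0); rewrite -natr1 in d0 *; field.
have := lerB_normD 1 (d%:R / d.+1%:R * (expi (2 * pi * t) - 1)).
rewrite -Em; apply: le_trans; rewrite normr1 rmorphB /= lerD2l lerN2.
rewrite normrM (le_trans (ler_piMl _ _)) //.
  by rewrite normrM normfV !normr_nat ler_pdivrMr ?ltr0n // mul1r ler_nat.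
rewrite E; apply: le_trans (norm_expi_sub1 _) _; rewrite lecR.
rewrite !normrM ger0_norm // (ger0_norm (pi_ge0 _)) !mulrA.
by rewrite -natrM.
Qed.

(** The exponential form turns products of masks into sums of distances. The linear bound may be
    negative away from the integers; the uniform bound [1 / (d + 1)] makes up for this. *)
Lemma norm_mask_expR (R : realType) (d : nat) (t : R) (n : int) :
  (1 < d)%N ->
  (expR (- (4 * pi * d.+1%:R * `|t - n%:~R|)))%:C <= `|ifs_mask d t|.
Proof.
move=> d1; have := norm_mask_near_int d t n; have := norm_mask_ge t d1.
rewrite normc_def !lecR; set m := Num.sqrt _; set e := `|_|.
move=> m0 me; have D0 : (0 : R) < d.+1%:R by rewrite ltr0n.
have mp : 0 < m by apply: lt_le_trans m0; rewrite invr_gt0.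
rewrite expRN invf_ple ?posrE ?expR_gt0 //.
apply: le_trans (expR_ge1Dx _).
(* 1 / m = 1 + (1 - m) / m <= 1 + 4 pi e (d + 1) <= exp (4 pi e (d + 1)) *)
have mV : m^-1 <= d.+1%:R by rewrite invf_ple ?posrE.
have -> : m^-1 = 1 + (1 - m) * m^-1 by field; rewrite gt_eqF.
rewrite lerD2l mulrAC.
apply: (@le_trans _ _ (4 * pi * e * m^-1)).
  by rewrite ler_pM2r ?invr_gt0 //; lra.
by rewrite ler_wpM2l // !mulr_ge0 ?pi_ge0 ?normr_ge0.
Qed.

Lemma norm_prod_mask_ge (R : realType) (d : nat) (D theta : R) (x : nat -> R) :
  (1 < d)%N -> 0 <= D -> 0 <= theta -> theta < 1 ->
  (forall j, exists n : int, `|x j - n%:~R| <= D * theta ^+ j) ->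
  exists2 c : R, 0 < c &
    forall k, c%:C <= `|\prod_(j < k) ifs_mask d (x j)|.
Proof.
move=> d1 D0 t0 t1 xD; set K := 4 * pi * d.+1%:R : R.
have K0 : 0 <= K by rewrite !mulr_ge0 ?pi_ge0.
exists (expR (- (K * (D / (1 - theta))))); first exact: expR_gt0.
move=> k; have Hk : (expR (- (K * (D * \sum_(j < k) theta ^+ j))))%:C
    <= `|\prod_(j < k) ifs_mask d (x j)|.
  rewrite normr_prod mulr_sumr mulr_sumr -sumrN expR_sum rmorph_prod /=.
  apply: ler_prod => j _; rewrite lecR expR_ge0 /=.
  have [n Hn] := xD j; apply: le_trans (norm_mask_expR _ n d1).
  by rewrite lecR ler_expR lerN2 ler_wpM2l.
(* The partial geometric sums are at most [1 / (1 - theta)], whence a bound independent of [k]. *)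
apply: le_trans Hk; rewrite lecR ler_expR lerN2 ler_wpM2l // ler_wpM2l //.
rewrite -[X in _ <= X]mul1r ler_pdivlMr ?subr_gt0 // mulrC.
by rewrite -[1 - theta]opprB mulNr -subrX1 opprB gerBl exprn_ge0.
Qed.

(** * Integration against a self-similar measure *)

Lemma measurable_tau (R : realType) (d : nat) (lambda : R) (b : 'cV[R]_d) :
  measurable_fun setT (tau lambda b : borel_space R d -> borel_space R d).
Proof.
have ct : continuous (tau lambda b : 'cV[R]_d -> 'cV[R]_d).
  move=> x A [P Px PA].
  (* Neighbourhoods of a matrix contain boxes, so continuity is checked entry by entry. *)
  exists (fun i j => (fun y : R => lambda * (y + b i j)) @^-1` P i j).
    move=> i j; have := Px i j; rewrite !mxE.
    have : (fun y : R => lambda * (y + b i j)) @ x i j --> lambda * (x i j + b i j).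
      by apply: cvgM; [exact: cvg_cst|apply: cvgD; [exact: cvg_id|exact: cvg_cst]].
    by apply.
  by move=> y Py; apply: PA => i j; rewrite !mxE; exact: Py.
have := @measurability _ _ (borel_space R d) (borel_space R d) setT (tau lambda b) _ erefl.
apply=> _ [A oA <-]; rewrite setTI; apply: sub_gen_smallest.
by move/continuousP : ct; apply.
Qed.

Lemma measurable_dotv (R : realType) (d : nat) (v : 'cV[R]_d) :
  measurable_fun setT (dotv v : borel_space R d -> R).
Proof.
apply: measurable_sum => i; apply: measurable_funM; first exact: measurable_cst.
apply: (measurability _ (RGenOpens.measurableE R)) => _ [_ [a [b ->] <-]].
rewrite setTI; apply: sub_gen_smallest.
have /continuousP := @coord_continuous R d 1 i 0.
by apply; exact: interval_open.
Qed.

Lemma bounded_Rintegrable dsp (T : measurableType dsp) (R : realType)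
    (mu : probability T R) (f : T -> R) (M : R) :
  measurable_fun setT f -> (forall x, `|f x| <= M) ->
  mu.-integrable setT (EFin \o f).
Proof.
move=> mf fM; apply: measurable_bounded_integrable => //.
  by rewrite (le_lt_trans (probability_le1 _ _)) // ltry.
exists M; split; first exact: num_real.
by move=> y My x _; exact: le_trans (fM x) (ltW My).
Qed.

(** Invariance says that [mu] is a scaled sum of its pushforwards under the maps [tau]; integrals of
    nonnegative functions then follow by change of variables. *)
Lemma hutchinson_ge0_integral (R : realType) (d : nat) (lambda : R)
    (mu : probability (borel_space R d) R) (f : borel_space R d -> \bar R) :
  hutchinson_measure lambda mu -> measurable_fun setT f ->
  (forall x, (0 <= f x)%E) ->
  (\int[mu]_x f x =
    (d.+1%:R^-1)%:E * \sum_(b <- digits R d) \int[mu]_x f (tau lambda b x))%E.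
Proof.
move=> Hmu mf f0.
have sd : size (digits R d) = d.+1 by rewrite /= size_image card_ord.
pose t n := tau lambda (nth 0 (digits R d) n).
pose mt n := measurable_tau lambda (nth 0 (digits R d) n).
pose m_ n : {measure set (borel_space R d) -> \bar R} :=
  measure_function_pushforward__canonical__measure_function_Measure mu (mt n).
have k0 : 0 <= (d.+1%:R^-1 : R) by rewrite invr_ge0.
pose k := NngNum k0.
rewrite (@eq_measure_integral _ _ _ setT (mscale k (msum m_ d.+1))); last first.
  move=> A mA _; apply: etrans (Hmu A mA) _; rewrite /mscale /msum /=.
  by rewrite (big_nth 0) sd big_mkord.
rewrite ge0_integral_mscale // ge0_integral_measure_sum //.
congr (_ * _)%E; rewrite [in RHS](big_nth 0) sd big_mkord; apply: eq_bigr => i _.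
by rewrite ge0_integral_pushforward.
Qed.

(* Reduces to the nonnegative case by adding the constant 1 to f. *)
Lemma hutchinson_Rintegral (R : realType) (d : nat) (lambda : R)
    (mu : probability (borel_space R d) R) (f : borel_space R d -> R) :
  hutchinson_measure lambda mu -> measurable_fun setT f ->
  (forall x, `|f x| <= 1) ->
  \int[mu]_x f x =
    d.+1%:R^-1 * \sum_(b <- digits R d) \int[mu]_x f (tau lambda b x).
Proof.
move=> Hmu mf f1.
have sd : size (digits R d) = d.+1 by rewrite /= size_image card_ord.
have mft b : measurable_fun setT (fun x : borel_space R d => f (tau lambda b x)).
  by apply: (measurableT_comp mf); exact: measurable_tau.
have int1 (h : borel_space R d -> R) : measurable_fun setT h ->
    (forall x, `|h x| <= 1) -> \int[mu]_x (1 + h x) = 1 + \int[mu]_x h x.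
  move=> mh h1; rewrite RintegralD //.
  - by rewrite Rintegral_cst // (_ : _ setT = 1%E) ?mulr1 //; exact: probability_setT.
  - by apply: (@bounded_Rintegrable _ _ _ _ _ `|1|) => //; exact: measurable_cst.
  - exact: bounded_Rintegrable mh h1.
have fin (h : borel_space R d -> R) : measurable_fun setT h ->
    (forall x, `|h x| <= 1) -> (\int[mu]_x (1 + h x)%:E \is a fin_num)%E.
  move=> mh h1; apply: integrable_fin_num => //.
  apply: (@bounded_Rintegrable _ _ _ _ _ 2).
    by apply: measurable_funD => //; exact: measurable_cst.
  move=> x; rewrite (le_trans (ler_normD _ _)) // normr1 -[2]/(1 + 1) lerD2l.
  exact: h1.
have E : \int[mu]_x (1 + f x) =
    d.+1%:R^-1 * \sum_(b <- digits R d) \int[mu]_x (1 + f (tau lambda b x)).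
  rewrite {1}/Rintegral (@hutchinson_ge0_integral _ _ lambda) //; first last.
  - by move=> x; rewrite lee_fin -lerBlDl sub0r; have := f1 x; rewrite ler_norml => /andP[].
  - apply/measurable_EFinP; apply: measurable_funD => //; exact: measurable_cst.
  rewrite fineM //; last by rewrite sum_fin_num; apply/allP => y /mapP[b _ ->]; apply: fin.
  by rewrite -sum_fine // => b _; exact: fin.
(* The added constant averages to 1 over the [d + 1] digits and cancels. *)
move: E; rewrite int1 //; under eq_bigr => b _ do rewrite int1 //.
rewrite big_split /= mulrDr => /(canRL (addKr _)) ->.
rewrite (_ : \sum_(_ <- _) 1 = d.+1%:R).
  by rewrite mulVf ?pnatr_eq0 // addKr.
by rewrite big_const_seq count_predT iter_addr_0 sd.
Qed.

Section Expi.
Variables (dsp : measure_display) (T : measurableType dsp) (R : realType).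
Variables (mu : probability T R) (u : T -> R).
Hypothesis mfu : measurable_fun setT u.

Lemma measurable_cos_comp : measurable_fun setT (fun x => cos (u x)).
Proof.
by apply: measurableT_comp => //; apply: continuous_measurable_fun; exact: continuous_cos.
Qed.

Lemma measurable_sin_comp : measurable_fun setT (fun x => sin (u x)).
Proof.
by apply: measurableT_comp => //; apply: continuous_measurable_fun; exact: continuous_sin.
Qed.

Lemma Cintegral_expiD (c : R) :
  Cintegral mu (fun x => expi (c + u x)) =
    expi c * Cintegral mu (fun x => expi (u x)).
Proof.
have icos : mu.-integrable setT (EFin \o (fun x => cos (u x))).
  exact: bounded_Rintegrable measurable_cos_comp (fun x => cos_max (u x)).
have isin : mu.-integrable setT (EFin \o (fun x => sin (u x))).
  exact: bounded_Rintegrable measurable_sin_comp (fun x => sin_max (u x)).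
have iZ (a : R) (f : T -> R) : mu.-integrable setT (EFin \o f) ->
    mu.-integrable setT (EFin \o (fun x => a * f x)).
  by move=> fi; exact: (integrableZl measurableT a fi).
rewrite /Cintegral /expi /=; simpc; congr (_ +i* _).
  under eq_Rintegral => x _ do rewrite cosD.
  by rewrite RintegralB ?RintegralZl //; exact: iZ.
under eq_Rintegral => x _ do rewrite sinD addrC.
by rewrite RintegralD ?RintegralZl //; exact: iZ.
Qed.

End Expi.

Lemma sum_complex (R : rcfType) (I : Type) (r : seq I) (a b : I -> R) :
  \sum_(i <- r) (a i +i* b i)%C = ((\sum_(i <- r) a i) +i* (\sum_(i <- r) b i))%C.
Proof.
elim: r => [|i r IH]; first by rewrite !big_nil.
by rewrite !big_cons IH; simpc.
Qed.

Lemma hutchinson_Cintegral_expi (R : realType) (d : nat) (lambda : R)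
    (mu : probability (borel_space R d) R) (u : borel_space R d -> R) :
  hutchinson_measure lambda mu -> measurable_fun setT u ->
  Cintegral mu (fun x => expi (u x)) =
    d.+1%:R^-1 * \sum_(b <- digits R d)
       Cintegral mu (fun x => expi (u (tau lambda b x))).
Proof.
move=> Hmu mfu; rewrite /Cintegral sum_complex.
rewrite (hutchinson_Rintegral Hmu (measurable_cos_comp mfu)); last by move=> x; exact: cos_max.
rewrite (hutchinson_Rintegral Hmu (measurable_sin_comp mfu)); last by move=> x; exact: sin_max.
have -> : (d.+1%:R^-1 : R[i]) = (d.+1%:R^-1 : R)%:C.
  by rewrite rmorphV ?unitfE ?pnatr_eq0 //= rmorph_nat.
by simpc.
Qed.

(** * Functional equation of the Fourier transform on the diagonal *)

Lemma sum_expi_digits (R : realType) (d : nat) (lambda xi : R) :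
  \sum_(b <- digits R d) expi (2 * pi * (lambda * dotv (const_mx xi) b)) =
    1 + d%:R * expi (2 * pi * (lambda * xi)).
Proof.
rewrite /digits big_cons big_image /= /dotv; congr (_ + _).
  rewrite big1 => [|i _]; last by rewrite !mxE mulr0.
  by rewrite !mulr0 expi0.
rewrite (eq_bigr (fun=> expi (2 * pi * (lambda * xi)))).
  by rewrite sumr_const card_ord [RHS]mulr_natl.
move=> j _; rewrite (bigD1 j) //= big1 ?addr0 ?mxE ?eqxx ?mulr1 //.
by move=> i ij; rewrite !mxE (negbTE ij) mulr0.
Qed.

(** The phase at [tau lambda b x] splits into a constant depending on [b] and the phase of [x] at
    frequency [lambda * xi]; the constants sum to the mask. *)
Lemma fourier_diag_rec (R : realType) (d : nat) (lambda : R)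
    (mu : probability (borel_space R d) R) (xi : R) :
  hutchinson_measure lambda mu ->
  fourier_diag mu xi = ifs_mask d (lambda * xi) * fourier_diag mu (lambda * xi).
Proof.
move=> Hmu; rewrite /fourier_diag /fourier.
have md (v : 'cV[R]_d) :
    measurable_fun setT (fun x : borel_space R d => 2 * pi * dotv v x).
  by apply: measurable_funM; [exact: measurable_cst|exact: measurable_dotv].
rewrite (hutchinson_Cintegral_expi Hmu) // /ifs_mask -sum_expi_digits -mulrA.
congr (_ * _); rewrite mulr_suml; apply: eq_bigr => b _.
rewrite -Cintegral_expiD //; congr (Cintegral _ _); apply/funext => x.
congr expi; rewrite -mulrDr; congr (_ * _).
rewrite /dotv mulr_sumr -big_split /=; apply: eq_bigr => i _.
by rewrite !mxE; ring.
Qed.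

Lemma fourier_diag_prod (R : realType) (d : nat) (lambda : R)
    (mu : probability (borel_space R d) R) (xi : R) (N : nat) :
  hutchinson_measure lambda mu ->
  fourier_diag mu xi =
    \prod_(1 <= n < N.+1) ifs_mask d (lambda ^+ n * xi) * fourier_diag mu (lambda ^+ N * xi).
Proof.
move=> Hmu; elim: N => [|N IH]; first by rewrite big_nil expr0 !mul1r.
rewrite big_nat_recr //= {1}IH (fourier_diag_rec _ Hmu) mulrA.
by rewrite exprS -mulrA [in LHS]mulrCA mulrCA -!mulrA.
Qed.

(** * Convergence of the infinite product and nonvanishing *)

(** Dominated convergence for the cosine and sine parts: the phases tend to 0 pointwise and the
    constant 1 dominates. *)
Lemma fourier_diag_cvg1 (R : realType) (d : nat) (lambda : R)
    (mu : probability (borel_space R d) R) (xi : R) :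
  0 <= lambda < 1 -> forall e : R, 0 < e ->
  exists N0, forall N, (N0 <= N)%N -> `|fourier_diag mu (lambda ^+ N * xi) - 1| <= e%:C.
Proof.
move=> /andP[l0 l1] e e0.
pose u := fun x : borel_space R d => 2 * pi * dotv (const_mx xi) x.
have mfu : measurable_fun setT u.
  by apply: measurable_funM; [exact: measurable_cst|exact: measurable_dotv].
have Eu N : fourier_diag mu (lambda ^+ N * xi) =
    Cintegral mu (fun x => expi (lambda ^+ N * u x)).
  congr (Cintegral _ _); apply/funext => x; congr expi; rewrite /u mulrCA.
  congr (_ * _); rewrite /dotv mulr_sumr; apply: eq_bigr => i _.
  by rewrite !mxE mulrA.
have mfN N : measurable_fun setT (fun x => lambda ^+ N * u x).
  by exact: (measurable_funM (measurable_cst (lambda ^+ N)) mfu).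
have cl x : lambda ^+ N * u x @[N --> \oo] --> 0.
  rewrite -[X in _ --> X](mul0r (u x)); apply: cvgMr_tmp.
  by apply: cvg_expr; rewrite ger0_norm.
have lim (g : R -> R) : (forall y, `|g y| <= 1) -> continuous g ->
    \int[mu]_x g (lambda ^+ N * u x) @[N --> \oo] --> g 0.
  move=> g1 cg; have mg := continuous_measurable_fun cg.
  have mgN N : measurable_fun setT (fun x => g (lambda ^+ N * u x)).
    exact: measurableT_comp mg (mfN N).
  have H1 N : measurable_fun setT (fun x => (g (lambda ^+ N * u x))%:E).
    exact/measurable_EFinP.
  have H3 : {ae mu, forall x, setT x ->
      (g (lambda ^+ N * u x))%:E @[N --> \oo] --> (g 0)%:E}.
    apply: aeW => x _; apply: cvg_EFin; first exact: nearW.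
    exact: (cvg_comp _ _ (cl x) (cg 0)).
  have H4 : mu.-integrable setT (EFin \o (cst 1 : borel_space R d -> R)).
    by apply: (@bounded_Rintegrable _ _ _ mu (cst 1) 1 (measurable_cst _)) => x; rewrite /= normr1.
  have H5 : {ae mu, forall x N, setT x ->
      (`|(g (lambda ^+ N * u x))%:E| <= (EFin \o cst 1%R) x)%E}.
    by apply: aeW => x N _; rewrite lee_fin.
  have [_ _] := dominated_convergence measurableT H1 (measurable_cst _) H3 H4 H5.
  rewrite integral_cst // (_ : _ setT = 1%E) ?mule1; last exact: probability_setT.
  exact: fine_cvg.
have limcos := lim cos (@cos_max R) (@continuous_cos R).
have limsin := lim sin (@sin_max R) (@continuous_sin R).
have e2 : 0 < e / 2 by rewrite divr_gt0.
move/cvgrPdist_le : limcos => /(_ _ e2) [N1 _ HN1].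
move/cvgrPdist_le : limsin => /(_ _ e2) [N2 _ HN2].
exists (maxn N1 N2) => N; rewrite geq_max => /andP[h1 h2].
rewrite Eu /Cintegral; apply: le_trans (norm_complex_le _) _.
rewrite lecR [leRHS]splitr /=; apply: lerD.
  by have := HN1 N h1; rewrite cos0 distrC.
by have := HN2 N h2; rewrite sin0 sub0r normrN subr0.
Qed.

Lemma fourier_diag_cvg (R : realType) (d : nat) (lambda : R)
    (mu : probability (borel_space R d) R) (xi : R) :
  0 <= lambda < 1 -> hutchinson_measure lambda mu ->
  (\prod_(1 <= n < N.+1) ifs_mask d (lambda ^+ n * xi) : R[i]^o) @[N --> \oo]
    --> (fourier_diag mu xi : R[i]^o).
Proof.
move=> l01 Hmu; apply/cvgrPdist_le => /= e e0.
(* A positive element of [R[i]] has zero imaginary part, so [e] is real. *)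
have [r r0 ->] : exists2 r : R, 0 < r & e = r%:C.
  move: e0; case: e => a b; rewrite ltcE /= => /andP[/eqP -> a0].
  by exists a.
have [N0 HN0] := fourier_diag_cvg1 mu xi l01 r0.
exists N0 => // N /= /HN0; apply: le_trans.
(* The error is the partial product, of modulus at most 1, times
   [fourier_diag mu (lambda ^+ N * xi) - 1]. *)
rewrite (fourier_diag_prod xi N Hmu) -[X in _ - X]mulr1 -mulrBr normrM.
rewrite ler_piMl // normr_prod.
by apply: prodr_ile1 => n _; rewrite normr_ge0 norm_mask_le1.
Qed.

(** For large [N] the transform at [lambda ^+ N * xi] is within 1/2 of 1, hence nonzero, and only
    finitely many nonzero masks separate it from the value at [xi]. *)
Lemma fourier_diag_neq0 (R : realType) (d : nat) (lambda : R)
    (mu : probability (borel_space R d) R) (xi : R) :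
  (1 < d)%N -> 0 <= lambda < 1 -> hutchinson_measure lambda mu ->
  fourier_diag mu xi != 0.
Proof.
move=> d1 l01 Hmu.
have h0 : 0 < 2^-1 :> R by rewrite invr_gt0.
have [N /(_ N (leqnn N)) HN] := fourier_diag_cvg1 mu xi l01 h0.
rewrite (fourier_diag_prod xi N Hmu) mulf_neq0 //.
  rewrite prodf_seq_neq0; apply/allP => n _ /=.
  rewrite -normr_gt0; apply: lt_le_trans (norm_mask_ge _ d1).
  by rewrite ltcR invr_gt0 ltr0n.
apply: contraTneq HN => ->; rewrite sub0r normrN normr1 -[1]/(1%:C) lecR.
by rewrite -ltNge invf_lt1 // ltr1n.
Qed.

Lemma fourier_diag_pow (R : realType) (d : nat) (alpha : R)
    (mu : probability (borel_space R d) R) (k : nat) :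
  alpha != 0 -> hutchinson_measure alpha^-1 mu ->
  fourier_diag mu (alpha ^+ k) =
    \prod_(j < k) ifs_mask d (alpha ^+ j) * fourier_diag mu 1.
Proof.
move=> a0 Hmu; elim: k => [|k IH]; first by rewrite big_ord0 mul1r.
by rewrite (fourier_diag_rec _ Hmu) exprS mulKf // IH big_ord_recr mulrCA mulrA.
Qed.

Theorem theorem5p1 (R : realType) (d : nat) (alpha : R)
    (mu : probability (borel_space R d) R) :
  (2 < d)%N -> pisot alpha -> hutchinson_measure alpha^-1 mu ->
  (forall xi : R,
     (\prod_(1 <= n < N.+1)
        ((d.+1%:R)^-1 * (1 + d%:R * expi (2 * pi * (alpha^-1 ^+ n * xi))))
        : R[i]^o) @[N --> \oo] --> (fourier_diag mu xi : R[i]^o)) /\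
  (exists2 c : R, 0 < c &
     forall k : nat, (0 < k)%N -> c%:C <= `|fourier_diag mu (alpha ^+ k)|).
Proof.
move=> /ltnW d1 pis Hmu; have [_ a1 _] := pis.
have a0 : 0 < alpha by apply: lt_trans a1.
have l01 : 0 <= alpha^-1 < 1 by rewrite invr_ge0 ltW //= invf_lt1.
split=> [xi|]; first exact: fourier_diag_cvg.
have [D [theta [D0 t0 t1 near]]] := pisot_near_int pis.
have [c c0 Hc] := norm_prod_mask_ge d1 D0 t0 t1 near.
have := fourier_diag_neq0 1 d1 l01 Hmu; rewrite -normr_gt0 normc_def ltcR.
set m := Num.sqrt _ => m0.
(* [c] bounds the mask products uniformly in [k], and [m] is the modulus of the transform at 1. *)
exists (c * m) => [|k _]; first exact: mulr_gt0.
rewrite fourier_diag_pow ?gt_eqF // normrM rmorphM /= [X in _ <= _ * X]normc_def -/m.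
by apply: ler_wpM2r (Hc k); rewrite lecR ltW.
Qed.
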